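(* Let $F:[a,b]\times\mathbb R^d\to\mathbb R^d$ and $u_0\in\mathbb R^d$. Let $U$ be an integral solution of $D_gU=F(t,U)$, $U(a)=u_0$. Then $$DU=F(\cdot,U)\,\mu_g$$ as vector measures on $[a,b)$ and, after restriction to $(a,b)$, as classical distributions. Conversely, if $U:[a,b]\to\mathbb R^d$ is left-continuous, belongs to $BV([a,b];\mathbb R^d)$, satisfies $U(a)=u_0$, and fulfills $DU=F(\cdot,U)\,\mu_g$ as an equality of finite vector measures on $[a,b)$, then $U$ satisfies the Stieltjes integral equation $$U(t)=u_0+\int_{[a,t)}F(s,U(s))\,d\mu_g(s),\qquad t\in[a,b].$$
   Context: Let $a<b$ be real, $d\in\mathbb N$, and let $g:[a,b]\to\mathbb R$ be nondecreasing and left-continuous. $\mu_g$ is the finite Lebesgue--Stieltjes measure on $[a,b)$ with $\mu_g([s,t))=g(t)-g(s)$ for $a\le s\le t\le b$. Standing assumption: $M_g:=\mu_g([a,b))=g(b)-g(a)>0$. $L_g^1([a,b))$ is the $L^1$ space for the completion of $\mu_g$; vector-valued spaces and integrals are componentwise. $AC_g([a,b];\mathbb R^d)$ is the set of functions $u:[a,b]\to\mathbb R^d$ such that, in each component, for every $\varepsilon>0$ there is $\delta>0$ such that, for every finite family of pairwise disjoint intervals $[a_j,b_j)\subset[a,b)$, $\sum_j(g(b_j)-g(a_j))<\delta$ implies $\sum_j|u(b_j)-u(a_j)|<\varepsilon$; equivalently (known), $u(t)=u(a)+\int_{[a,t)}v\,d\mu_g$ for all $t\in[a,b]$ with some $v\in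 L_g^1$, which is $\mu_g$-a.e. unique and denoted $D_gu$. Such functions are left-continuous and of bounded variation. $U\in AC_g([a,b];\mathbb R^d)$ is an integral solution of $D_gU=F(t,U)$, $U(a)=u_0$, if $F(\cdot,U(\cdot))\in L_g^1$ and $U(t)=u_0+\int_{[a,t)}F(s,U(s))\,d\mu_g(s)$ for all $t\in[a,b]$. For a left-continuous $U\in BV([a,b];\mathbb R^d)$, $DU$ denotes the canonical finite vector Borel measure on $[a,b)$ characterized by $DU([s,t))=U(t)-U(s)$ for $a\le s\le t\le b$; its restriction to $(a,b)$ is the classical distributional derivative. The notation $F(\cdot,U)\mu_g$ for a finite vector measure means the measure with density $F(\cdot,U(\cdot))\in L_g^1$ with respect to $\mu_g$. *)

(* Defs.v *)
From HB Require Import structures.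
From mathcomp Require Import all_boot all_order all_algebra.
From mathcomp Require Import all_classical all_reals all_analysis.
From mathcomp Require Import ring.

Set Implicit Arguments.
Unset Strict Implicit.
Unset Printing Implicit Defensive.

Import Order.TTheory GRing.Theory Num.Theory.
Import numFieldNormedType.Exports.

Local Open Scope classical_set_scope.
Local Open Scope ring_scope.

(* Functions on [a, b] are total functions on R: every notion below only
   depends on their values on [a, b]. *)

Definition left_continuous_on (R : realType) (a b : R) (u : R -> R) : Prop :=
  forall t, a < t -> t <= b -> u x @[x --> t^'-] --> u t.

(* The measures on [a, b) are represented by measures on the Borel sets of R
   carried by [a, b). *)
Definition has_stieltjes_increments (R : realType) (a b : R) (u : R -> R)
    (nu : set (measurableTypeR R) -> \bar R) : Prop :=
  (forall s t, a <= s -> s <= t -> t <= b ->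
    nu `[s, t[%classic = (u t - u s)%:E) /\
  (forall A : set (measurableTypeR R), measurable A ->
    A `&` `[a, b[%classic = set0 -> nu A = 0%E).

(* The measure or charge characterized by these increments is selected by
   choice, with default value 0; the default is not used when u is
   nondecreasing (resp. of bounded variation) and left-continuous, see
   [stieltjes_measureP], [stieltjes_chargeP] and, for uniqueness,
   [has_stieltjes_increments_unique]. *)
Definition stieltjes_measure (R : realType) (a b : R) (u : R -> R) :
    {measure set (measurableTypeR R) -> \bar R} :=
  match pselect (exists mu : {measure set (measurableTypeR R) -> \bar R},
                   has_stieltjes_increments a b u mu) with
  | left e => projT1 (cid e)
  | right _ => mzero
  end.

Definition stieltjes_charge (R : realType) (a b : R) (u : R -> R) :
    {charge set (measurableTypeR R) -> \bar R} :=
  match pselect (exists nu : {charge set (measurableTypeR R) -> \bar R},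
                   has_stieltjes_increments a b u nu) with
  | left e => projT1 (cid e)
  | right _ => czero
  end.

Section stieltjes_theory.
Context (R : realType).
Implicit Types (a b : R) (u g : R -> R).

Let clamp a b (x : R) : R := Num.max a (Num.min b x).

Let clamp_in a b x : a <= b -> a <= clamp a b x <= b.
Proof. by move=> ab; rewrite /clamp le_max lexx/= ge_max ab ge_min lexx. Qed.

Let clamp_id a b x : a <= x -> x <= b -> clamp a b x = x.
Proof. by move=> ax xb; rewrite /clamp min_r// max_r. Qed.

Let clamp_le a b x y : x <= y -> clamp a b x <= clamp a b y.
Proof. by move=> xy; exact/le_max2/le_min2. Qed.

Lemma has_stieltjes_increments_unique a b u
    (nu1 nu2 : {charge set (measurableTypeR R) -> \bar R}) : a <= b ->
  has_stieltjes_increments a b u nu1 -> has_stieltjes_increments a b u nu2 ->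
  forall A, measurable A -> nu1 A = nu2 A.
Proof.
move=> ab [nu1I nu10] [nu2I nu20].
have mab : measurable (`[a, b[%classic : set (measurableTypeR R)) by [].
have carried (nu : {charge set (measurableTypeR R) -> \bar R}) A :
    (forall A : set (measurableTypeR R), measurable A ->
      A `&` `[a, b[%classic = set0 -> nu A = 0%E) ->
    measurable A -> nu A = nu (A `&` `[a, b[).
  move=> nu0 mA; rewrite [LHS](chargeDI nu mA mab).
  have -> : nu (A `\` `[a, b[%classic) = 0%E; last by rewrite add0e.
  by apply: nu0; [exact: measurableD|rewrite setDE -setIA setICl setI0].
move=> A mA.
have GE := measurable_realfun.RGenInftyO.measurableE R.
have : (measurable_realfun.RGenInftyO.G (R:=R)).-sigma.-measurable A by rewrite -GE.
move: A {mA}; apply: (@dynkin_induction _ (measurableTypeR R)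
  (measurable_realfun.RGenInftyO.G (R:=R)) (fun A => nu1 A = nu2 A)).
- exact: GE.
- move=> _ _ [x ->] [y ->]; exists (Num.min x y); apply/seteqP; split => z /=;
    by rewrite !in_itv/= lt_min => /andP.
- by rewrite (carried nu1)// (carried nu2)// setTI nu1I// nu2I.
- move=> _ [x ->]; rewrite (carried nu1)// (carried nu2)//.
  have -> : `]-oo, x[%classic `&` `[a, b[%classic =
      `[a, clamp a b x[%classic :> set R.
    apply/seteqP; split => z /=; rewrite !in_itv/= /clamp lt_max lt_min.
      by case=> zx /andP[az zb]; rewrite az zx zb orbT.
    case/andP => az /orP[za|/andP[zb zx]]; first by move: az; rewrite leNgt za.
    by rewrite az zb zx.
  have /andP[ax xb] := @clamp_in a b x ab.
  by rewrite nu1I// nu2I.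
- move=> S mS h.
  rewrite -setTD !chargeD// !setTI h.
  by congr (_ - _)%E; rewrite (carried nu1)// (carried nu2)// setTI nu1I// nu2I.
- move=> F mF tF h.
  have mU : measurable (\bigcup_k F k) by exact: bigcup_measurable.
  have c1 := @charge_semi_sigma_additive _ _ _ nu1 F mF tF mU.
  have c2 := @charge_semi_sigma_additive _ _ _ nu2 F mF tF mU.
  have E : (fun n => \sum_(0 <= i < n) nu1 (F i))%E =
      (fun n => \sum_(0 <= i < n) nu2 (F i))%E.
    by apply/funext => n; apply: eq_bigr.
  by rewrite E in c1; exact: (cvg_unique _ c1 c2).
Qed.

Let lebesgue_stieltjes_measure_itv (h : cumulative R R) (x y : R) : x <= y ->
  lebesgue_stieltjes_measure h `]x, y]%classic = (h y - h x)%:E.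
Proof.
move=> xy; rewrite /lebesgue_stieltjes_measure /measure_extension/=.
rewrite measurable_mu_extE/=; last exact: is_ocitv.
by rewrite wlength_itv_bnd.
Qed.

Lemma stieltjes_measure_exists a b g : a <= b ->
  {in `[a, b] &, nondecreasing_fun g} -> left_continuous_on a b g ->
  exists mu : {finite_measure set (measurableTypeR R) -> \bar R},
    has_stieltjes_increments a b g mu.
Proof.
move=> ab gnd glc.
pose h x := - g (clamp a b (- x)).
have hnd : nondecreasing h.
  move=> x y xy; rewrite /h lerN2; apply: gnd; rewrite ?in_itv/= ?clamp_in//.
  by rewrite clamp_le// lerN2.
have hrc : right_continuous h.
  move=> x; apply: cvgN; rewrite -[x]opprK.
  apply/(@cvg_at_leftNP _ _ (g \o clamp a b)) => /=; rewrite opprK.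
  set y := - x.
  have [ya|ay] := leP y a.
    apply: cvg_near_cst; near=> z => /=; congr g.
    have za : z <= a by apply: le_trans ya; near: z; exact: nbhs_left_le.
    rewrite /clamp !min_r ?(le_trans za)// ?(le_trans ya)//.
    by rewrite !max_l.
  have [yb|by_] := leP y b.
    rewrite (clamp_id (ltW ay) yb).
    apply: cvg_trans (glc _ ay yb); apply: near_eq_cvg; near=> z.
    rewrite /= clamp_id//; first by near: z; exact: nbhs_left_ge.
    by apply: le_trans yb; near: z; exact: nbhs_left_le.
  apply: cvg_near_cst; near=> z => /=; congr g.
  have bz : b <= z by near: z; exact: nbhs_left_ge.
  by rewrite /clamp !min_l ?(ltW by_).
pose hm := isCumulative.Build R _ R h hnd hrc.
pose hc : cumulative R R := HB.pack h hm.
pose nu := lebesgue_stieltjes_measure hc.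
have mN : measurable_fun [set: measurableTypeR R]
    (-%R : measurableTypeR R -> measurableTypeR R).
  exact: measurable_realfun.oppr_measurable.
pose mu00 : {measure set (measurableTypeR R) -> \bar R} :=
  pushforward nu (-%R : measurableTypeR R -> measurableTypeR R).
pose mu0 := mu00 mN.
have mu0E s t : a <= s -> s <= t -> t <= b ->
    mu0 `[s, t[%classic = (g t - g s)%:E.
  move=> as_ st tb; rewrite /mu0/= /pushforward.
  have -> : -%R @^-1` `[s, t[%classic = `](- t), (- s)]%classic :> set R.
    by apply/seteqP; split => z /=; rewrite !in_itv/= lerNr ltrNl andbC.
  rewrite /nu lebesgue_stieltjes_measure_itv ?lerN2//= /h !opprK !clamp_id//.
  - by rewrite addrC.
  - exact: le_trans st.
  - exact: le_trans tb.
have mab : measurable (`[a, b[%classic : set (measurableTypeR R)) by [].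
pose mu1 : {measure set (measurableTypeR R) -> \bar R} := mrestr mu0 mab.
have fmu1 : fin_num_fun mu1.
  move=> A mA; rewrite ge0_fin_numE; last exact: measure_ge0.
  rewrite -[mu1 A]/(mu0 (A `&` `[a, b[%classic)).
  apply: (@le_lt_trans _ _ (mu0 `[a, b[%classic)).
    by apply: le_measure; rewrite ?inE//; exact: measurableI.
  by rewrite mu0E// ltry.
pose fm := Measure_isFinite.Build _ (measurableTypeR R) R mu1 fmu1.
pose mu : {finite_measure set (measurableTypeR R) -> \bar R} :=
  HB.pack (Measure.sort mu1) fm.
exists mu; split => [s t as_ st tb|A mA A0]; last first.
  by rewrite -[mu A]/(mu0 (A `&` `[a, b[%classic)) A0 measure0.
rewrite -[mu _]/(mu0 (`[s, t[%classic `&` `[a, b[%classic)).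
rewrite setIidl ?mu0E//.
move=> z /=; rewrite !in_itv/= => /andP[sz zt].
by rewrite (le_trans as_ sz) (lt_le_trans zt tb).
Unshelve. all: by end_near. Qed.

Lemma stieltjes_measureP a b g : a <= b ->
  {in `[a, b] &, nondecreasing_fun g} -> left_continuous_on a b g ->
  has_stieltjes_increments a b g (stieltjes_measure a b g).
Proof.
move=> ab gnd glc; rewrite /stieltjes_measure; case: pselect => [e|[]].
  by case: (cid e).
by have [mu ?] := stieltjes_measure_exists ab gnd glc; exists mu.
Qed.

Lemma stieltjes_chargeP a b u : a <= b ->
  bounded_variation a b u -> left_continuous_on a b u ->
  has_stieltjes_increments a b u (stieltjes_charge a b u).
Proof.
move=> ab ubv ulc; rewrite /stieltjes_charge; case: pselect => [e|[]].
  by case: (cid e).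
pose V t := fine (total_variation a t u).
have Vfin t : a <= t -> t <= b -> total_variation a t u \is a fin_num.
  by move=> at_ tb; apply/bounded_variationP => //; exact: (bounded_variationl at_ tb ubv).
have Vlc : left_continuous_on a b V.
  by move=> t at_ tb; exact: (total_variation_left_continuous at_ tb (ulc _ at_ tb) ubv).
have Vinc x y : a <= x -> x <= y -> y <= b -> `|u y - u x| <= V y - V x.
  move=> ax xy yb; have ay := le_trans ax xy; have xb := le_trans xy yb.
  rewrite -lee_fin EFinB /V !fineK ?Vfin//.
  rewrite (total_variationD u ax xy) [X in (X - _)%E]addeC addeK ?Vfin//.
  exact: total_variation_ge.
have Vnd : {in `[a, b] &, nondecreasing_fun V}.
  move=> x y; rewrite !in_itv/= => /andP[ax xb] /andP[ay yb] xy.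
  by rewrite -subr_ge0 (le_trans _ (Vinc _ _ ax xy yb)).
have Wlc : left_continuous_on a b (V \- u).
  by move=> t at_ tb; apply: cvgB; [exact: Vlc|exact: ulc].
have Wnd : {in `[a, b] &, nondecreasing_fun (V \- u)}.
  move=> x y; rewrite !in_itv/= => /andP[ax xb] /andP[ay yb] xy.
  rewrite -subr_ge0 /= (_ : _ - _ - _ = (V y - V x) - (u y - u x)); last by ring.
  by rewrite subr_ge0 (le_trans (ler_norm _))// Vinc.
have [m1 [m1I m10]] := stieltjes_measure_exists ab Vnd Vlc.
have [m2 [m2I m20]] := stieltjes_measure_exists ab Wnd Wlc.
exists (cadd (charge_of_finite_measure m1)
  (cscale (-1) (charge_of_finite_measure m2))).
split => [s t as_ st tb|A mA A0].
  rewrite -[LHS]/(m1 `[s, t[%classic + (-1)%:E * m2 `[s, t[%classic)%E.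
  by rewrite m1I// m2I// -EFinM -EFinD; congr EFin; rewrite /=; ring.
rewrite -[LHS]/(m1 A + (-1)%:E * m2 A)%E.
by rewrite m10// m20// mule0 adde0.
Qed.

End stieltjes_theory.

Notation completed_stieltjes_measure a b u :=
  (@completed_measure_extension _ _ _ (stieltjes_measure a b u)).

Section stieltjes.
Context (R : realType) (a b : R) (g : R -> R) (d : nat).

Local Notation mu := (completed_stieltjes_measure a b g).

Definition L1g (v : R -> 'rV[R]_d) : Prop :=
  forall i, mu.-integrable `[a, b[%classic (fun s => (v s 0 i)%:E).

Definition integral_g (A : set R) (v : R -> 'rV[R]_d) : 'rV[R]_d :=
  \row_i \int[mu]_(s in A) v s 0 i.

(* the i-th component of the vector measure [v mu_g], used on Borel subsets of
   [a, b) *)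
Definition density_g (v : R -> 'rV[R]_d) (i : 'I_d) (A : set R) : \bar R :=
  (\int[mu]_(s in A) (v s 0 i)%:E)%E.

Definition AC_g (U : R -> 'rV[R]_d) : Prop :=
  forall i, forall e : R, 0 < e -> exists2 delta : R, 0 < delta &
    forall (n : nat) (l r : 'I_n -> R),
      (forall j, a <= l j /\ l j < r j /\ r j <= b) ->
      trivIset [set: 'I_n] (fun j => `[l j, r j[%classic) ->
      \sum_(j < n) (g (r j) - g (l j)) < delta ->
      \sum_(j < n) `|U (r j) 0 i - U (l j) 0 i| < e.

Definition integral_equation (F : R -> 'rV[R]_d -> 'rV[R]_d) (u0 : 'rV[R]_d)
    (U : R -> 'rV[R]_d) : Prop :=
  forall t, a <= t -> t <= b ->
    U t = u0 + integral_g `[a, t[%classic (fun s => F s (U s)).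

Definition integral_solution (F : R -> 'rV[R]_d -> 'rV[R]_d) (u0 : 'rV[R]_d)
    (U : R -> 'rV[R]_d) : Prop :=
  [/\ AC_g U, L1g (fun s => F s (U s)) & integral_equation F u0 U].

Definition test_function (phi : R -> R) : Prop :=
  [/\ forall n x, derivable (derive1n n phi) x 1,
      compact (closure [set x | phi x != 0]) &
      closure [set x | phi x != 0] `<=` `]a, b[%classic].

Definition distributional_derivative (u : R -> R) (phi : R -> R) : R :=
  - \int[lebesgue_measure]_(x in `]a, b[) (u x * derive1 phi x).

(* the distribution on (a, b) given by the restriction of [v mu_g] *)
Definition density_distribution (v : R -> 'rV[R]_d) (i : 'I_d) (phi : R -> R) :
    R :=
  \int[mu]_(s in `]a, b[) (phi s * v s 0 i).

End stieltjes.

(* Main.v *)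
(** The increment of an integral solution over [s, t) is the integral of its
    density over [s, t), so the density measure and DU agree on intervals, hence
    on Borel sets by uniqueness of the charge with given increments.  For a test
    function phi, Fubini's theorem on the triangle {s < x} moves the integral
    of phi' inside: integrating phi' over (s, b) gives - phi(s), and phi(a) = 0
    disposes of a possible atom at a.  Conversely, the integral equation is the
    equality of measures evaluated on [a, t). *)

Require Import Defs.
From HB Require Import structures.
From mathcomp Require Import all_boot all_order all_algebra.
From mathcomp Require Import all_classical all_reals all_analysis.
From mathcomp Require Import measurable_realfun.

Set Implicit Arguments.
Unset Strict Implicit.
Unset Printing Implicit Defensive.

Import Order.TTheory GRing.Theory Num.Theory.
Import numFieldNormedType.Exports.

Local Open Scope classical_set_scope.
Local Open Scope ring_scope.

(** * Fubini on the triangle and integration by parts against test functions *)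

Section triangle_Fubini.
Context d (T : measurableType d) (R : realType).
Variables (mu : {sigma_finite_measure set T -> \bar R})
  (nu : {sigma_finite_measure set (measurableTypeR R) -> \bar R}).
Variables (h : T -> measurableTypeR R) (f : T -> R) (k : measurableTypeR R -> R).
Hypothesis mh : measurable_fun [set: T] h.
Hypothesis intf : mu.-integrable [set: T] (EFin \o f).
Hypothesis intk : nu.-integrable [set: measurableTypeR R] (EFin \o k).

(** Cutting off to the region [h s < x] keeps the integrand below the full product [f s * k x] in
    absolute value, and by Tonelli that product is integrable. *)
Lemma integrable_prod_below : (nu \x mu)%E.-integrable
  [set: measurableTypeR R * T]
  (fun z => (if h z.2 < z.1 then f z.2 * k z.1 else 0)%:E).
Proof.
have mf : measurable_fun [set: T] f.
  by apply/measurable_EFinP; exact: measurable_int intf.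
have mk : measurable_fun [set: measurableTypeR R] k.
  by apply/measurable_EFinP; exact: measurable_int intk.
have mfk : measurable_fun [set: measurableTypeR R * T]
    (fun z => f z.2 * k z.1).
  apply: measurable_funM.
    exact: measurableT_comp mf measurable_snd.
  exact: measurableT_comp mk measurable_fst.
have intfk : (nu \x mu)%E.-integrable [set: measurableTypeR R * T]
    (fun z => (f z.2 * k z.1)%:E).
  apply/integrable12ltyP; first exact/measurable_EFinP.
  (* The iterated integral of the absolute value factors into the product of the two finite L1
     norms. *)
  have fE x : (\int[mu]_s `|(f s * k x)%:E| =
      \int[mu]_s `|(f s)%:E| * `|(k x)%:E|)%E.
    rewrite -ge0_integralZr//; last first.
      by apply: measurableT_comp => //; exact/measurable_EFinP.
    by apply: eq_integral => s _; rewrite EFinM abseM.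
  under eq_integral do rewrite fE.
  rewrite ge0_integralZl//; last 2 first.
  - by apply: measurableT_comp => //; exact/measurable_EFinP.
  - exact: integral_ge0.
  apply: lte_mul_pinfty; first exact: integral_ge0.
  - rewrite ge0_fin_numE; last exact: integral_ge0.
    by case/integrableP : intf.
  - by case/integrableP : intk.
apply: le_integrable intfk => //.
- apply/measurable_EFinP; apply: measurable_fun_ifT => //.
  apply: measurable_fun_ltr => //.
  exact: measurableT_comp mh measurable_snd.
- by move=> z _ /=; case: ifP => // _; rewrite normr0 lee_fin.
Qed.

Let integral_below x :
  (\int[mu]_s (if (h s < x)%R then f s * k x else 0)%:E =
   ((\int[mu]_(s in h @^-1` `]-oo, x[) f s) * k x)%:E)%E.
Proof.
have mA : measurable (h @^-1` `]-oo, x[).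
  by rewrite -[X in measurable X]setTI; exact: mh.
have intA : mu.-integrable (h @^-1` `]-oo, x[) (EFin \o f).
  exact: integrableS intf.
rewrite /Rintegral EFinM fineK; last exact: integrable_fin_num.
rewrite -integralZr// [RHS]integral_mkcond; apply: eq_integral => s _.
rewrite patchE (_ : (s \in _) = (h s < x)); first by case: ifPn.
by apply/idP/idP; rewrite inE/= in_itv.
Qed.

Let integral_above s :
  (\int[nu]_x (if (h s < x)%R then f s * k x else 0)%:E =
   (f s * \int[nu]_(x in `]h s, +oo[) k x)%:E)%E.
Proof.
have intA : nu.-integrable `]h s, +oo[ (EFin \o k) by exact: integrableS intk.
rewrite /Rintegral EFinM fineK; last exact: integrable_fin_num.
rewrite -integralZl// [RHS]integral_mkcond; apply: eq_integral => x _.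
by rewrite patchE mem_setE in_itv/= andbT; case: ifPn.
Qed.

(** This is the inner integral in Fubini's theorem, hence integrable; the integration by parts needs
    it to split a sum under the integral. *)
Lemma integrable_mul_integral_below : nu.-integrable [set: measurableTypeR R]
  (fun x => ((\int[mu]_(s in h @^-1` `]-oo, x[) f s) * k x)%:E).
Proof.
under eq_fun do rewrite -integral_below.
exact: integrable_fubini_F integrable_prod_below.
Qed.

(** The two sides are the iterated integrals of the same cut-off product: its section at [s] lives
    on []h s, +oo[], its section at [x] on the preimage of []-oo, x[]. *)
Lemma Rintegral_triangle_swap :
  \int[mu]_s (f s * \int[nu]_(x in `]h s, +oo[) k x) =
  \int[nu]_x ((\int[mu]_(s in h @^-1` `]-oo, x[) f s) * k x).
Proof.
rewrite /Rintegral; congr fine.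
under eq_integral do rewrite -integral_above.
under [RHS]eq_integral do rewrite -integral_below.
by rewrite (Fubini integrable_prod_below).
Qed.

End triangle_Fubini.

(* To be used with [h] the identity from the completed sigma-algebra, which is
   finer than the Borel one. *)
Lemma Rintegral_by_parts_stieltjes d (T : measurableType d) (R : realType)
    (mu : {sigma_finite_measure set T -> \bar R}) (h : T -> measurableTypeR R)
    (a b c : R) (f : T -> R) (phi : R -> R) :
  measurable_fun [set: T] h -> a < b ->
  mu.-integrable (h @^-1` `[a, b[) (EFin \o f) ->
  (forall x, derivable phi x 1) -> continuous (derive1 phi) ->
  phi a = 0 -> phi b = 0 ->
  - (\int[lebesgue_measure]_(x in `]a, b[)
      ((c + \int[mu]_(s in h @^-1` `[a, x[) f s) * derive1 phi x)) =
  \int[mu]_(s in h @^-1` `]a, b[) (phi (h s) * f s).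
Proof.
move=> mh ab intf dphi cphi' phia phib.
have mpre (A : set (measurableTypeR R)) : measurable A -> measurable (h @^-1` A).
  by move=> mA; rewrite -[X in measurable X]setTI; exact: mh.
have intphi' s : lebesgue_measure.-integrable `[s, b] (EFin \o derive1 phi).
  apply: continuous_compact_integrable; first exact: segment_compact.
  exact: continuous_subspaceT.
have intphi'o s : lebesgue_measure.-integrable `]s, b[ (EFin \o derive1 phi).
  by apply: integrableS (intphi' s) => //; exact: subset_itv_oo_cc.
have ftc s : s < b ->
    \int[lebesgue_measure]_(x in `]s, b[) derive1 phi x = - phi s.
  move=> sb.
  (* Endpoints are Lebesgue-null, so the interval may be closed before applying the fundamental
     theorem of calculus. *)
  rewrite Rintegral_itv_obnd_cbnd; last first.
    by apply: integrableS (intphi' s) => //; exact: subset_itv_oo_cc.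
  rewrite Rintegral_itv_bndo_bndc; last first.
    by apply: integrableS (intphi' s) => //; exact: subset_itv_co_cc.
  have cphi x : {for x, continuous phi}.
    exact/differentiable_continuous/derivable1_diffP.
  have FTC : (\int[lebesgue_measure]_(x in `[s, b]) (derive1 phi x)%:E =
      (phi b)%:E - (phi s)%:E)%E.
    apply: (continuous_FTC2 sb); [exact: continuous_subspaceT| |by []].
    split => [x _||].
    - exact: dphi.
    - exact/cvg_at_right_filter/cphi.
    - exact/cvg_at_left_filter/cphi.
  by rewrite /Rintegral FTC/= phib sub0r.
(* Extension by zero makes the swap on the whole spaces applicable; the sign in [k] makes its
   integral over []s, b[] equal to [phi s] for [a <= s < b]. *)
pose f0 := f \_ (h @^-1` `[a, b[).
pose k : R -> R := (fun x => - derive1 phi x) \_ `]a, b[.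
have intf0 : mu.-integrable [set: T] (EFin \o f0).
  by rewrite -restrict_EFin; apply/(integrable_mkcond _ (mpre _ _)).
have mitv : measurable (`]a, b[%classic : set (measurableTypeR R)) by [].
have intk : lebesgue_measure.-integrable [set: measurableTypeR R] (EFin \o k).
  rewrite -restrict_EFin; apply/(integrable_mkcond _ mitv).
  exact: integrableN (intphi'o a).
have belowE : (fun x => (\int[mu]_(s in h @^-1` `]-oo, x[) f0 s) * k x) =
    (fun x => - ((\int[mu]_(s in h @^-1` `[a, x[) f s) * derive1 phi x)) \_ `]a, b[.
  apply/funext => x; rewrite /k !patchE; case: ifPn; rewrite ?mulr0// mem_setE.
  rewrite in_itv/= => /andP[ax xb]; rewrite -mulrN; congr (_ * _).
  rewrite Rintegral_mkcond [RHS]Rintegral_mkcond; apply: eq_Rintegral => s _.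
  rewrite /f0 !patchE.
  rewrite (_ : (s \in h @^-1` `]-oo, x[) = (h s < x)); last first.
    by apply/idP/idP; rewrite inE/= in_itv.
  rewrite (_ : (s \in h @^-1` `[a, b[) = (a <= h s < b)); last first.
    by apply/idP/idP; rewrite inE/= in_itv.
  rewrite (_ : (s \in h @^-1` `[a, x[) = (a <= h s < x)); last first.
    by apply/idP/idP; rewrite inE/= in_itv.
  case: (ltP (h s) x) => hx; rewrite ?andbF// ?andbT.
  by rewrite (lt_trans hx xb) andbT.
have aboveE : (fun s => f0 s * \int[lebesgue_measure]_(x in `]h s, +oo[) k x) =
    (fun s => phi (h s) * f s) \_ (h @^-1` `]a, b[).
  apply/funext => s; rewrite /f0 !patchE.
  rewrite (_ : (s \in h @^-1` `[a, b[) = (a <= h s < b)); last first.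
    by apply/idP/idP; rewrite inE/= in_itv.
  rewrite (_ : (s \in h @^-1` `]a, b[) = (a < h s < b)); last first.
    by apply/idP/idP; rewrite inE/= in_itv.
  have [hb|bh] := ltP (h s) b; last by rewrite !andbF mul0r.
  rewrite !andbT; have [ah|ha] := leP a (h s); last first.
    by rewrite ltNge (ltW ha) mul0r.
  have -> : \int[lebesgue_measure]_(x in `]h s, +oo[) k x = phi (h s).
    rewrite -[RHS]opprK -ftc// -mulN1r -RintegralZl//.
    rewrite Rintegral_mkcond [RHS]Rintegral_mkcond.
    apply: eq_Rintegral => x _; rewrite /k !patchE !mem_setE !in_itv/= andbT.
    case: (ltP (h s) x) => hx //=.
    by rewrite (le_lt_trans ah hx) mulN1r.
  (* At [h s = a], where [mu] may have an atom, the left side vanishes because [phi a = 0] and the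
     right side because [a] is excluded. *)
  move: ah; rewrite le_eqVlt => /predU1P[<-|->]; last by rewrite mulrC.
  by rewrite phia mulr0 ltxx.
have intV : lebesgue_measure.-integrable `]a, b[
    (EFin \o (fun x => (\int[mu]_(s in h @^-1` `[a, x[) f s) * derive1 phi x)).
  have intNV : lebesgue_measure.-integrable `]a, b[ (EFin \o (fun x =>
      - ((\int[mu]_(s in h @^-1` `[a, x[) f s) * derive1 phi x))).
    apply/(integrable_mkcond _ mitv); rewrite restrict_EFin -belowE.
    exact: (integrable_mul_integral_below (nu := lebesgue_measure) mh intf0 intk).
  have := integrableN intNV; apply: eq_integrable => // x _.
  by rewrite /= opprK.
have := Rintegral_triangle_swap (nu := lebesgue_measure) mh intf0 intk.
rewrite aboveE belowE -!Rintegral_mkcond => ->.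
(* The constant contributes [c] times the integral of [derive1 phi] over []a, b[], that is
   [- c * phi a = 0]. *)
under eq_Rintegral do rewrite mulrDl.
rewrite RintegralD//; last exact: integrableZl (intphi'o a).
rewrite RintegralZl// ftc// phia oppr0 mulr0 add0r -mulN1r -RintegralZl//.
by apply: eq_Rintegral => x _; rewrite mulN1r.
Qed.

(** * The density measure as a charge on Borel sets *)

Lemma measurable_completed (R : realType)
    (mu : {measure set (measurableTypeR R) -> \bar R})
    (A : set (measurableTypeR R)) :
  measurable A -> measurable (A : set (caratheodory_type (mu^*)%mu)).
Proof. by move=> mA; apply: sub_caratheodory; exact: sub_sigma_algebra. Qed.

Lemma measurable_id_completed (R : realType)
    (mu : {measure set (measurableTypeR R) -> \bar R}) :
  measurable_fun [set: caratheodory_type (mu^*)%mu] (id : _ -> measurableTypeR R).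
Proof. by move=> _ A mA; rewrite setTI; exact: measurable_completed. Qed.

Section stieltjes_density.
Context (R : realType) (a b : R) (g v : R -> R).

Local Notation mu := (completed_stieltjes_measure a b g).

Hypothesis intv : mu.-integrable `[a, b[%classic (EFin \o v).

Let mu_measurable (A : set (measurableTypeR R)) : measurable A ->
  measurable (A : set (caratheodory_type ((stieltjes_measure a b g)^*)%mu)).
Proof. exact: measurable_completed. Qed.

(** Integrating the zero extension of [v] gives a charge on the completed sigma-algebra; its
    pushforward along the identity is the restriction to Borel sets. *)
Lemma density_charge : exists nu : {charge set (measurableTypeR R) -> \bar R},
  forall A, measurable A -> nu A = (\int[mu]_(s in A `&` `[a, b[) (v s)%:E)%E.
Proof.
have mab := mu_measurable (measurable_itv `[a, b[).
have mid := @measurable_id_completed _ (stieltjes_measure a b g).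
have intv' := (integrable_mkcond _ mab).1 intv.
pose nu : {charge set (measurableTypeR R) -> \bar R} :=
  pushforward (induced_charge intv') (id : _ -> measurableTypeR R).
exists (nu mid) => A mA.
rewrite -[LHS]/(\int[mu]_(s in A) ((EFin \o v) \_ `[a, b[) s)%E.
by rewrite integral_mkcondr.
Qed.

Lemma integral_increments (u : R -> R) (c : R)
    (nu : set (measurableTypeR R) -> \bar R) :
  (forall A, measurable A -> nu A = (\int[mu]_(s in A `&` `[a, b[) (v s)%:E)%E) ->
  (forall t, a <= t -> t <= b -> u t = c + \int[mu]_(s in `[a, t[) v s) ->
  has_stieltjes_increments a b u nu.
Proof.
move=> nuE uE; split=> [s t as_ st tb|A mA A0]; last first.
  by rewrite nuE// A0 integral_set0.
have at_ := le_trans as_ st; have sb := le_trans st tb.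
have sub (x y : R) : a <= x -> y <= b -> `[x, y[%classic `<=` `[a, b[%classic.
  move=> ax yb z /=; rewrite !in_itv/= => /andP[xz zy].
  by rewrite (le_trans ax xz) (lt_le_trans zy yb).
rewrite nuE; last exact: measurable_itv.
rewrite setIidl; last exact: sub.
have int_itv (x y : R) : a <= x -> y <= b ->
    mu.-integrable `[x, y[%classic (EFin \o v).
  move=> ax yb; apply: integrableS intv; last exact: sub.
  - exact: mu_measurable (measurable_itv _).
  - exact: mu_measurable (measurable_itv _).
have fin_itv (x y : R) : a <= x -> y <= b ->
    (\int[mu]_(s in `[x, y[) (v s)%:E)%E \is a fin_num.
  move=> ax yb; apply: integrable_fin_num; last exact: int_itv.
  exact: mu_measurable (measurable_itv _).
rewrite -[LHS]fineK; last exact: fin_itv.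
congr EFin; rewrite !uE//; apply/eqP; rewrite eq_sym subr_eq; apply/eqP.
rewrite addrCA; congr (c + _); rewrite addrC.
(* The increment formula is additivity of the integral over [[a, t[], the disjoint union of [[a, s[]
   and [[s, t[]. *)
rewrite -/(Rintegral mu `[s, t[ v) -Rintegral_setU.
- congr Rintegral; apply/seteqP; split=> z /=; rewrite !in_itv/=.
    by move=> /andP[az zt]; case: (ltP z s) => zs; [left|right]; rewrite ?az.
  move=> [/andP[az zs]|/andP[sz zt]]; first by rewrite az (lt_le_trans zs st).
  by rewrite zt (le_trans as_ sz).
- exact: mu_measurable (measurable_itv _).
- exact: mu_measurable (measurable_itv _).
- apply: integrableS intv => //.
  + exact: mu_measurable (measurable_itv _).
  + by apply: measurableU; exact: mu_measurable (measurable_itv _).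
  + by move=> z [|]; apply: sub.
- apply/disj_setPS => z /= []; rewrite !in_itv/= => /andP[_ zs] /andP[sz _].
  by move: zs; rewrite ltNge sz.
Qed.

Lemma stieltjes_charge_density (u : R -> R) (c : R) : a <= b ->
  (forall t, a <= t -> t <= b -> u t = c + \int[mu]_(s in `[a, t[) v s) ->
  forall A : set (measurableTypeR R), measurable A -> A `<=` `[a, b[ ->
  stieltjes_charge a b u A = (\int[mu]_(s in A) (v s)%:E)%E.
Proof.
move=> ab uE A mA Aab; have [nu nuE] := density_charge.
have nuI := integral_increments nuE uE.
rewrite -[in RHS](setIidl Aab) -nuE//.
apply: (has_stieltjes_increments_unique ab _ nuI mA).
(* The density charge itself witnesses existence, so the choice does not fall back on the default
   [czero]. *)
rewrite /stieltjes_charge; case: pselect => [e|[]]; first by case: (cid e).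
by exists nu.
Qed.

End stieltjes_density.

(** Supplies the sigma-finiteness that Fubini's theorem asks for: the Stieltjes measure is carried
    by [[a, b[], so its total mass is the finite number [g b - g a]. *)
Lemma completed_stieltjes_sigma_finite (R : realType) (a b : R) (g : R -> R) :
  a <= b -> {in `[a, b] &, nondecreasing_fun g} -> left_continuous_on a b g ->
  sigma_finite setT (completed_stieltjes_measure a b g).
Proof.
move=> ab gnd glc; have [gI g0] := stieltjes_measureP ab gnd glc.
apply: completed_measure_extension_sigma_finite.
apply: fin_num_fun_sigma_finite; first by rewrite measure0.
move=> A mA; rewrite ge0_fin_numE; last exact: measure_ge0.
pose m : set (measurableTypeR R) -> \bar R := stieltjes_measure a b g.
have mab : measurable (`[a, b[%classic : set (measurableTypeR R)) by [].
have mabC := measurableC mab.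
have mT : m setT = (m `[a, b[%classic + m (~` `[a, b[%classic))%E.
  rewrite -(setUv (`[a, b[%classic : set (measurableTypeR R))) /m.
  by rewrite measureU ?setICr.
apply: (@le_lt_trans _ _ (m setT)); first by apply: le_measure; rewrite ?inE.
by rewrite mT /m (gI a b)// (g0 _ mabC) ?setICl// adde0 ltry.
Qed.

Lemma test_function_notin (R : realType) (a b : R) (phi : R -> R) (x : R) :
  test_function a b phi -> x \notin `]a, b[ -> phi x = 0.
Proof.
move=> [_ _ sub]; apply: contraNeq => phix.
by apply: sub; exact: subset_closure.
Qed.

Theorem corollary9p3 (R : realType) (a b : R) (d : nat) (g : R -> R)
    (F : R -> 'rV[R]_d -> 'rV[R]_d) (u0 : 'rV[R]_d)
    (ab : a < b)
    (g_nondecreasing : {in `[a, b] &, nondecreasing_fun g})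
    (g_left_continuous : left_continuous_on a b g)
    (g_mass : 0 < g b - g a) :
  (forall U : R -> 'rV[R]_d, integral_solution a b g F u0 U ->
    (forall (i : 'I_d) (A : set (measurableTypeR R)), measurable A -> A `<=` `[a, b[%classic ->
      stieltjes_charge a b (fun t => U t 0 i) A =
      density_g a b g (fun s => F s (U s)) i A) /\
    (forall (i : 'I_d) (phi : R -> R), test_function a b phi ->
      distributional_derivative a b (fun t => U t 0 i) phi =
      density_distribution a b g (fun s => F s (U s)) i phi)) /\
  (forall U : R -> 'rV[R]_d,
    (forall i, left_continuous_on a b (fun t => U t 0 i)) ->
    (forall i, bounded_variation a b (fun t => U t 0 i)) ->
    U a = u0 ->
    L1g a b g (fun s => F s (U s)) ->
    (forall (i : 'I_d) (A : set (measurableTypeR R)), measurable A -> A `<=` `[a, b[%classic ->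
      stieltjes_charge a b (fun t => U t 0 i) A =
      density_g a b g (fun s => F s (U s)) i A) ->
    integral_equation a b g F u0 U).
Proof.
have ab' := ltW ab.
split=> [U [_ intF Ueq]|U Ulc Ubv Ua intF UF].
  have Ui i t : a <= t -> t <= b -> U t 0 i = u0 0 i +
      \int[completed_stieltjes_measure a b g]_(s in `[a, t[) F s (U s) 0 i.
    by move=> at_ tb; rewrite (Ueq t at_ tb) !mxE.
  split=> [i A mA Aab|i phi tphi].
    exact: (stieltjes_charge_density (intF i) ab' (Ui i)).
  have sfin := completed_stieltjes_sigma_finite ab' g_nondecreasing g_left_continuous.
  pose mu : {sigma_finite_measure set _ -> \bar R} := HB.pack
    (completed_stieltjes_measure a b g) (Measure_isSigmaFinite.Build _ _ _ _ sfin).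
  have mid := @measurable_id_completed _ (stieltjes_measure a b g).
  have dphi n := (let: And3 h _ _ := tphi in h) n.
  have phia : phi a = 0 by apply: test_function_notin tphi _; rewrite in_itv/= ltxx.
  have phib : phi b = 0.
    by apply: test_function_notin tphi _; rewrite in_itv/= ltxx andbF.
  have cphi' : continuous (derive1 phi).
    by move=> x; exact/differentiable_continuous/derivable1_diffP/(dphi 1%N).
  (* Here [h] is the identity, [f] the i-th component of the right-hand side along [U], and [c] the
     initial value, so that [c] plus the inner integral is the i-th component of [U]. *)
  have := Rintegral_by_parts_stieltjes (mu := mu) (u0 0 i) mid ab (intF i)
    (dphi 0%N) cphi' phia phib.
  rewrite /distributional_derivative /density_distribution => <-.
  congr (- _); apply: eq_Rintegral => x; rewrite inE/= in_itv/= => /andP[ax xb].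
  by rewrite (Ui i x (ltW ax) (ltW xb)).
move=> t at_ tb; apply/rowP => i; rewrite !mxE -Ua.
(* Bounded variation and left-continuity ensure that the chosen charge really has the increments of
   [U], so its value on [[a, t[] is [U t 0 i - U a 0 i]. *)
have [UI _] := stieltjes_chargeP ab' (Ubv i) (Ulc i).
have := UF i `[a, t[%classic (measurable_itv _).
rewrite UI// => E.
have {}E : ((U t 0 i - U a 0 i)%:E = density_g a b g (fun s => F s (U s)) i `[a, t[)%E.
  apply: E => z /=; rewrite !in_itv/= => /andP[-> zt].
  exact: lt_le_trans zt tb.
rewrite /Rintegral -/(density_g a b g (fun s => F s (U s)) i `[a, t[) -E/=.
by rewrite addrC subrK.
Qed.
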